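(* Let $p$ be a prime number and let $\{b(n)\}_{n\ge 0}$ be a strictly increasing sequence of nonnegative integers with $b(0)=1$ such that $b(n+1)/b(n)\to\infty$ as $n\to\infty$. Suppose that $a_0,a_1,a_2,\ldots$ are nonzero polynomials in $\mathbb{F}_p[t]$ such that: (1) $a_0\in t\mathbb{F}_p[t]$; (2) $a_i\notin t\mathbb{F}_p[t]$ for some $i>0$; (3) there is a positive constant $C$ such that $\deg(a_n)\le C\cdot b(n)$ for all $n\ge 1$. Then the power series $$f(x):=\sum_{n\ge 0}a_nx^{b(n)}\in\mathbb{F}_p[t][[x]]$$ has a root $\lambda$ in $\overline{\mathbb{F}}_p((t^{\mathbb{Q}}))_{>0}$ with $\lambda$ not algebraic over $\mathbb{F}_p(t)$. Moreover, $f(x)$ cannot be factored in $\mathbb{F}_p[t][[x]]$ as a product of a polynomial in $\mathbb{F}_p[t][x]$ and a unit of $\mathbb{F}_p[t][[x]]$.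
   Context: For a field $K$, $K((t^{\mathbb{Q}}))$ denotes the field of Hahn series: formal series $\sum_{\alpha\in\mathbb{Q}}c_\alpha t^\alpha$ with $c_\alpha\in K$ whose support $\{\alpha\in\mathbb{Q}: c_\alpha\ne 0\}$ is a well-ordered subset of $\mathbb{Q}$, with the usual addition and multiplication. The valuation of a nonzero such series is $\min\{\alpha: c_\alpha\ne 0\}$; it extends the $t$-adic valuation on $K((t))$. $K((t^{\mathbb{Q}}))_{>0}$ denotes the set of Hahn series with positive valuation (including $0$), i.e. the maximal ideal of the valuation ring. $\overline{\mathbb{F}}_p$ is an algebraic closure of $\mathbb{F}_p$, and $\mathbb{F}_p(t)\subseteq\mathbb{F}_p((t))\subseteq\overline{\mathbb{F}}_p((t^{\mathbb{Q}}))$. For $\lambda\in\overline{\mathbb{F}}_p((t^{\mathbb{Q}}))_{>0}$, $f(\lambda)$ is the limit, in the topology given by the valuation, of the partial sums; $\lambda$ is a root if $f(\lambda)=0$. *)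

(* Defs.v *)
From HB Require Import structures.
From mathcomp Require Import all_boot all_order all_algebra.
From mathcomp Require Import boolp classical_sets functions cardinality fsbigop.
From mathcomp Require Import reals constructive_ereal topology normedtype lra.

Set Implicit Arguments.
Unset Strict Implicit.
Unset Printing Implicit Defensive.
Set SsrOldRewriteGoalsOrder.

Import Order.TTheory GRing.Theory Num.Theory.
Import numFieldNormedType.Exports.
Local Open Scope classical_set_scope.
Local Open Scope ring_scope.

Definition least (A : set rat) : set rat := [set m | A m /\ forall x, A x -> m <= x].

Definition well_ordered (A : set rat) : Prop :=
  forall B : set rat, B `<=` A -> B !=set0 -> least B !=set0.

Lemma well_ordered_sub (A B : set rat) :
  A `<=` B -> well_ordered B -> well_ordered A.
Proof. by move=> AB woB C CA; apply: woB; apply: subset_trans AB. Qed.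

Lemma well_orderedU (A B : set rat) :
  well_ordered A -> well_ordered B -> well_ordered (A `|` B).
Proof.
move=> woA woB C CAB [c Cc].
have [[a Ca Aa]|nA] := pselect (exists2 a, C a & A a); last first.
  apply: woB; last by exists c.
  by move=> x Cx; case: (CAB x Cx) => // Ax; case: nA; exists x.
have [[b Cb Bb]|nB] := pselect (exists2 b, C b & B b); last first.
  apply: woA; last by exists c.
  by move=> x Cx; case: (CAB x Cx) => // Bx; case: nB; exists x.
have [|m [[Cm Am] lem]] := woA (C `&` A) (@subIsetr _ _ _); first by exists a.
have [|n [[Cn Bn] len]] := woB (C `&` B) (@subIsetr _ _ _); first by exists b.
have [lemn|ltnm] := leP m n.
  exists m; split=> // x Cx; case: (CAB x Cx) => [Ax|Bx]; first exact: lem.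
  exact: le_trans lemn (len _ _).
exists n; split=> // x Cx; case: (CAB x Cx) => [Ax|Bx]; last exact: len.
exact: le_trans (ltW ltnm) (lem _ _).
Qed.

Lemma well_ordered0 : well_ordered set0.
Proof. by move=> B; rewrite subset0 => -> [x []]. Qed.

Lemma well_ordered1 (a : rat) : well_ordered [set a].
Proof.
move=> B Ba [b Bb]; exists b; split=> // x /Ba ->.
by rewrite (Ba _ Bb).
Qed.

Lemma finite_well_ordered (A : set rat) : finite_set A -> well_ordered A.
Proof.
move=> /finite_seqP[s ->]; elim: s => [|a s IHs].
  by apply: well_ordered_sub well_ordered0 => x.
apply: well_ordered_sub (well_orderedU (@well_ordered1 a) IHs) => x /=.
by rewrite inE => /orP[/eqP ->|]; [left|right].
Qed.

(* A set of rationals that is well ordered for both <= and >= is finite. *)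
Lemma well_ordered_finite (A : set rat) : well_ordered A ->
  (forall B : set rat, B `<=` A -> B !=set0 ->
     exists2 m, B m & forall x, B x -> x <= m) ->
  finite_set A.
Proof.
move=> woA rwoA; have [->|/set0P A0] := eqVneq A set0; first exact: finite_set0.
pose init x := A `&` [set y | y <= x].
have [//|m0 [Am0 lem0]] := woA A _ A0.
have [||M [AM finM] leM] := rwoA (A `&` [set x | finite_set (init x)]).
- exact: subIsetl.
- exists m0; split=> //; apply: sub_finite_set (finite_set1 m0).
  by move=> x [/lem0 le1 le2]; apply/le_anti/andP.
have [[y Ay ltMy]|nM] := pselect (exists2 y, A y & M < y); last first.
  apply: sub_finite_set finM => x Ax; split=> //=.
  by rewrite leNgt; apply/negP => lt; apply: nM; exists x.
have [||m [[Am ltMm] lem]] := woA (A `&` [set x | M < x]).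
- exact: subIsetl.
- by exists y.
have /leM : (A `&` [set x | finite_set (init x)]) m.
  split=> //; apply: (@sub_finite_set _ _ (init M `|` [set m])).
    move=> x [Ax lexm]; have [lexM|ltMx] := leP x M; first by left.
    by right; apply/le_anti/andP; split=> //; apply: lem.
  by rewrite finite_setU; split=> //; apply: finite_set1.
by rewrite leNgt ltMm.
Qed.

Lemma finite_decomp (A B : set rat) (c : rat) :
  well_ordered A -> well_ordered B ->
  finite_set [set a | A a /\ B (c - a)].
Proof.
move=> woA woB; apply: well_ordered_finite.
  by apply: well_ordered_sub woA => x [].
move=> D DAB [d Dd].
have [||m [[x Dx <-] lem]] := woB [set c - x | x in D].
- by move=> _ [x /DAB[_ Bx] <-].
- by exists (c - d), d.
exists x => // y Dy; have : c - x <= c - y by apply: lem; exists y.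
by lra.
Qed.

(* Only the finitely many sums of Pareto-minimal pairs can be minimal. *)
Lemma well_orderedD (A B : set rat) : well_ordered A -> well_ordered B ->
  well_ordered [set x + y | x in A & y in B].
Proof.
move=> woA woB C CAB C0.
pose fiber b := [set a | A a /\ C (a + b)].
pose al b := xget 0 (least (fiber b)).
pose BC := B `&` [set b | fiber b !=set0].
have alP b : BC b -> least (fiber b) (al b).
  move=> [_ fib0]; apply: xgetPex; apply: woA fib0; exact: subIsetl.
pose P := BC `&` [set b | forall b', BC b' -> b' < b -> al b < al b'].
have domP a b : A a -> B b -> C (a + b) -> exists2 q, P q & al q + q <= a + b.
  move=> Aa Bb Cab; have BCb : BC b by split=> //; exists a.
  have leab : al b <= a by apply: (alP b BCb).2.
  have [||q [[BCq leqb leal] minq]] :=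
    woB [set q | [/\ BC q, q <= b & al q <= al b]].
  - by move=> q [[? _] _ _].
  - by exists b.
  exists q; last by lra.
  split=> // b' BCb' ltb'; rewrite ltNge; apply/negP => le'.
  have : q <= b' by apply: minq; split=> //; lra.
  by rewrite leNgt ltb'.
have finP : finite_set P.
  apply: well_ordered_finite; first by apply: well_ordered_sub woB => x [[]].
  move=> Q QP [q0 Qq0].
  have [||_ [[q Qq <-] minq]] := woA [set al q | q in Q].
  - by move=> _ [q Qq <-]; have [BCq _] := QP q Qq; have [[]] := alP q BCq.
  - by exists (al q0); exists q0.
  exists q => // x Qx; rewrite leNgt; apply/negP => ltqx.
  have [_ /(_ q _ ltqx)] := QP x Qx; have [BCq _] := QP q Qq.
  by move=> /(_ BCq); rewrite ltNge minq//; exists x.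
have [|_ [[q Pq <-] leq]] :=
    @finite_well_ordered [set al q + q | q in P] (finite_image _ finP) _
      (@subset_refl _ _).
  have [c Cc] := C0; have [a Aa [b Bb E]] := CAB c Cc; rewrite -E in Cc.
  by have [q Pq _] := domP a b Aa Bb Cc; exists (al q + q), q.
exists (al q + q); split; first by have [BCq _] := Pq; have [[]] := alP q BCq.
move=> c Cc; have [a Aa [b Bb E]] := CAB c Cc; rewrite -E in Cc *.
have [q' Pq' le'] := domP a b Aa Bb Cc; apply: le_trans le'.
by apply: leq; exists q'.
Qed.

Section HahnSeries.
Variable K : fieldType.

Definition hsupport (c : rat -> K) : set rat := [set a | c a != 0].

Record hahn := Hahn { hcoef :> rat -> K; hahn_wo : well_ordered (hsupport hcoef) }.

Arguments hahn_wo : clear implicits.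

Implicit Types f g h : hahn.

Lemma hahnP f g : hcoef f =1 hcoef g -> f = g.
Proof.
case: f g => [f wof] [g wog] /= /funext E; rewrite -E in wog *.
by congr Hahn; apply: Prop_irrelevance.
Qed.

HB.instance Definition _ := gen_eqMixin hahn.
HB.instance Definition _ := gen_choiceMixin hahn.

Definition hsingle_coef (a : rat) (x : K) (b : rat) : K := if b == a then x else 0.

Lemma hsingle_wo a x : well_ordered (hsupport (hsingle_coef a x)).
Proof.
apply: well_ordered_sub (@well_ordered1 a) => b.
rewrite /hsupport/= /hsingle_coef; have [->//|_] := eqVneq b a.
by rewrite eqxx.
Qed.

(* the monomial x t^a *)
Definition hsingle a x : hahn := Hahn (@hsingle_wo a x).

Lemma hadd_wo f g : well_ordered (hsupport (fun a => f a + g a)).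
Proof.
apply: (well_ordered_sub _ (well_orderedU (hahn_wo f) (hahn_wo g))) => a fg0.
have [f0|] := eqVneq (f a) 0; last by left.
by right; move: fg0; rewrite /hsupport/= f0 add0r.
Qed.

Lemma hopp_wo f : well_ordered (hsupport (fun a => - f a)).
Proof.
apply: (@well_ordered_sub _ (hsupport f) _ (hahn_wo f)) => a.
by rewrite /hsupport/= oppr_eq0.
Qed.

Definition hzero := hsingle 0 0.
Definition hadd f g := Hahn (@hadd_wo f g).
Definition hopp f := Hahn (@hopp_wo f).

Fact haddA : associative hadd.
Proof. by move=> f g h; apply: hahnP => a /=; rewrite addrA. Qed.
Fact haddC : commutative hadd.
Proof. by move=> f g; apply: hahnP => a /=; rewrite addrC. Qed.
Fact hadd0 : left_id hzero hadd.
Proof. by move=> f; apply: hahnP => a /=; rewrite /hsingle_coef if_same add0r. Qed.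
Fact haddN : left_inverse hzero hopp hadd.
Proof. by move=> f; apply: hahnP => a /=; rewrite /hsingle_coef if_same addNr. Qed.

HB.instance Definition _ := GRing.isZmodule.Build hahn haddA haddC hadd0 haddN.

(* [\sum_(a \in _)] sums over the finitely many [a] with a nonzero term. *)
Definition hmul_coef (f g : rat -> K) (c : rat) : K :=
  \sum_(a \in [set: rat]) f a * g (c - a).

Lemma hmul_finite f g c : finite_set [set a | f a * g (c - a) != 0].
Proof.
apply: sub_finite_set (finite_decomp c (hahn_wo f) (hahn_wo g)) => a /=.
by rewrite mulf_eq0 negb_or => /andP.
Qed.

Lemma hmul_coefE (s : seq rat) (f g : rat -> K) c : uniq s ->
  (forall a, f a * g (c - a) != 0 -> a \in s) ->
  hmul_coef f g c = \sum_(a <- s) f a * g (c - a).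
Proof.
move=> us hs; rewrite /hmul_coef (fsbigE s) //.
  by apply: eq_bigl => i; rewrite in_setT.
by move=> i _ nis; apply/eqP; apply: contraNT nis => /hs.
Qed.

Lemma hmul_coef_neq0 (f g : rat -> K) c : hmul_coef f g c != 0 ->
  exists a, f a != 0 /\ g (c - a) != 0.
Proof.
apply: contraNP => /forallNP nz.
rewrite (@hmul_coefE [::]) ?big_nil// => a.
by rewrite mulf_eq0 negb_or => /andP[fa ga]; case: (nz a).
Qed.

Lemma hmul_wo f g : well_ordered (hsupport (hmul_coef f g)).
Proof.
apply: (well_ordered_sub _ (well_orderedD (hahn_wo f) (hahn_wo g))) => c.
move=> /hmul_coef_neq0[a [fa0 ga0]].
by exists a => //; exists (c - a) => //; rewrite addrC subrK.
Qed.

Definition hone := hsingle 0 1.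
Definition hmul f g := Hahn (@hmul_wo f g).

Lemma finite_uniq_seq (A : set rat) : finite_set A ->
  exists2 s : seq rat, uniq s & forall a, A a -> a \in s.
Proof.
move=> /finite_seqP[s ->]; exists (undup s); first exact: undup_uniq.
by move=> a /=; rewrite mem_undup.
Qed.

Lemma hmul_seq f g c :
  exists2 s : seq rat, uniq s & forall a, f a * g (c - a) != 0 -> a \in s.
Proof. exact: finite_uniq_seq (hmul_finite f g c). Qed.

Fact hmulC : commutative hmul.
Proof.
move=> f g; apply: hahnP => c /=; have [s us hs] := hmul_seq f g c.
rewrite (hmul_coefE us hs) (@hmul_coefE [seq c - a | a <- s]).
- rewrite big_map; apply: eq_bigr => a _; rewrite mulrC; congr (g _ * f _).
  by lra.
- by rewrite map_inj_uniq // => x y /=; lra.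
- move=> a ga0; apply/mapP; exists (c - a); last by lra.
  apply: hs; rewrite mulrC; have -> // : c - (c - a) = a by lra.
Qed.

Fact hmul1 : left_id hone hmul.
Proof.
move=> f; apply: hahnP => c /=; rewrite (@hmul_coefE [:: 0]) //.
  by rewrite big_seq1 /hsingle_coef eqxx mul1r subr0.
move=> a; rewrite /hsingle_coef inE; have [//|_] := eqVneq a 0.
by rewrite mul0r eqxx.
Qed.

Fact hmulD : left_distributive hmul hadd.
Proof.
move=> f g h; apply: hahnP => c /=.
have [s _ hs] := hmul_seq f h c; have [s' _ hs'] := hmul_seq g h c.
have us : uniq (undup (s ++ s')) := undup_uniq _.
rewrite !(hmul_coefE us).
- by rewrite -big_split; apply: eq_bigr => a _ /=; rewrite mulrDl.
- by move=> a /hs'; rewrite mem_undup mem_cat orbC => ->.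
- by move=> a /hs; rewrite mem_undup mem_cat => ->.
move=> a; rewrite mem_undup mem_cat mulrDl /=.
have [->|/hs -> //] := eqVneq (f a * h (c - a)) 0.
by rewrite add0r => /hs' ->; rewrite orbT.
Qed.

Fact hmulA : associative hmul.
Proof.
move=> f g h; apply: hahnP => c /=.
have [U uU hU] : exists2 s : seq rat, uniq s & forall a u,
    f a != 0 -> g (u - a) != 0 -> h (c - u) != 0 -> u \in s.
  have wofg := well_orderedD (hahn_wo f) (hahn_wo g).
  have [s us hs] := finite_uniq_seq (finite_decomp c wofg (hahn_wo h)).
  exists s => // a u fa gua hcu; apply: hs; split=> //.
  by exists a => //; exists (u - a) => //; rewrite addrC subrK.
have [S uS hS] : exists2 s : seq rat, uniq s & forall a u,
    f a != 0 -> g (u - a) != 0 -> h (c - u) != 0 -> a \in s.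
  have /choice[F FP] : forall u, exists s : seq rat,
      forall a, f a * g (u - a) != 0 -> a \in s.
    by move=> u; have [s _ hs] := hmul_seq f g u; exists s.
  exists (undup (flatten [seq F u | u <- U])); first exact: undup_uniq.
  move=> a u fa gua hcu; rewrite mem_undup; apply/flattenP.
  exists (F u); first by apply: map_f; apply: hU fa gua hcu.
  by apply: FP; rewrite mulf_neq0.
rewrite (hmul_coefE uS); last first.
  move=> a; rewrite mulf_eq0 negb_or => /andP[fa /hmul_coef_neq0[b [gb hb]]].
  apply: (hS _ (b + a)) => //; first by rewrite addrK.
  by have -> : c - (b + a) = c - a - b by lra.
rewrite (hmul_coefE uU); last first.
  move=> u; rewrite mulf_eq0 negb_or => /andP[/hmul_coef_neq0[a [fa ga]] hu].
  exact: hU fa ga hu.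
transitivity (\sum_(a <- S) \sum_(u <- U) f a * g (u - a) * h (c - u)).
  apply: eq_bigr => a _; have [->|fa] := eqVneq (f a) 0.
    by rewrite mul0r big1// => u _; rewrite !mul0r.
  rewrite (@hmul_coefE [seq u - a | u <- U]).
  - rewrite big_map mulr_sumr; apply: eq_bigr => u _.
    by rewrite mulrA; have -> : c - a - (u - a) = c - u by lra.
  - by rewrite map_inj_uniq// => x y /=; lra.
  move=> b; rewrite mulf_eq0 negb_or => /andP[gb hb].
  apply/mapP; exists (b + a); last by rewrite addrK.
  apply: (hU a) => //; first by rewrite addrK.
  by have -> : c - (b + a) = c - a - b by lra.
rewrite exchange_big; apply: eq_bigr => u _ /=.
have [->|hu] := eqVneq (h (c - u)) 0.
  by rewrite mulr0 big1// => a _; rewrite mulr0.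
rewrite (hmul_coefE uS) ?mulr_suml// => a.
by rewrite mulf_eq0 negb_or => /andP[fa ga]; apply: hS fa ga hu.
Qed.

Fact hone_neq0 : hone != 0.
Proof.
apply/eqP => /(congr1 (fun f => hcoef f 0)) /=.
by rewrite /hsingle_coef eqxx => /eqP; rewrite oner_eq0.
Qed.

HB.instance Definition _ := GRing.Zmodule_isComNzRing.Build hahn
  hmulA hmulC hmul1 hmulD hone_neq0.

Lemma hcoef0 a : hcoef 0 a = 0.
Proof. by rewrite /= /hsingle_coef if_same. Qed.

Lemma hcoef1 a : hcoef 1 a = if a == 0 then 1 else 0.
Proof. by []. Qed.

Lemma hcoefD f g a : (f + g) a = f a + g a. Proof. by []. Qed.
Lemma hcoefN f a : (- f) a = - f a. Proof. by []. Qed.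
Lemma hcoefB f g a : (f - g) a = f a - g a. Proof. by []. Qed.
Lemma hcoefM f g : hcoef (f * g) = hmul_coef f g. Proof. by []. Qed.

Lemma hcoef_sum (I : Type) (r : seq I) (P : pred I) (F : I -> hahn) a :
  (\sum_(i <- r | P i) F i) a = \sum_(i <- r | P i) F i a.
Proof. by elim/big_rec2: _ => [|i x y _ <-]; rewrite ?hcoef0 ?hcoefD. Qed.

(* Inverses by the geometric series: [f] is normalised to [1 - y] with all
   exponents of [y] at least [v > 0], so that [y ^+ n] contributes to the
   coefficient of [t^c] only for [n * v <= c]. *)
Definition supp_ge (v : rat) f := forall a, f a != 0 -> v <= a.

Lemma supp_geM v w f g : supp_ge v f -> supp_ge w g -> supp_ge (v + w) (f * g).
Proof.
move=> fv gw c; rewrite hcoefM => /hmul_coef_neq0[a [/fv va /gw]]; lra.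
Qed.

Lemma supp_geX v f n : supp_ge v f -> supp_ge (v *+ n) (f ^+ n).
Proof.
move=> fv; elim: n => [|n IHn].
  rewrite expr0 mulr0n => a; rewrite hcoef1.
  by have [->|] := eqVneq a 0; rewrite ?eqxx.
by rewrite exprS mulrS; apply: supp_geM.
Qed.

Lemma hmul_local f g g' c : supp_ge 0 f ->
  (forall a, a <= c -> g a = g' a) -> (f * g) c = (f * g') c.
Proof.
move=> f0 gg'; rewrite !hcoefM /hmul_coef; apply: eq_fsbigr => a _.
have [->|/f0 a0] := eqVneq (f a) 0; first by rewrite !mul0r.
by rewrite gg'//; lra.
Qed.

Section Geometric.
Variables (y : hahn) (v : rat).
Hypotheses (v_gt0 : 0 < v) (yv : supp_ge v y).

Let N (c : rat) : nat := Num.bound `|c / v|.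

Let ltNv c n : (N c <= n)%N -> c < v *+ n.
Proof.
move=> leNn; have : c / v < n%:R.
  apply: le_lt_trans (ler_norm _) _.
  by apply: lt_le_trans (archi_boundP (normr_ge0 _)) _; rewrite ler_nat.
by rewrite ltr_pdivrMr// mulr_natl.
Qed.

Let partial n : hahn := \sum_(i < n) y ^+ i.

Let partialE c c' n : c' <= c -> (N c <= n)%N -> partial n c' = partial (N c) c'.
Proof.
move=> lec leNn; rewrite /partial -!(big_mkord predT (fun i => y ^+ i)).
rewrite (big_cat_nat (n := N c)) // hcoefD [X in _ + X]hcoef_sum.
rewrite [X in _ + X]big_nat_cond [X in _ + X]big1 ?addr0// => i.
case/andP=> /andP[leNi _] _.
apply/eqP; apply: contraT => /(supp_geX yv).
by rewrite leNgt (le_lt_trans lec)// ltNv.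
Qed.

Let geom_coef c := partial (N c) c.

Let geom_coefE c c' : c' <= c -> geom_coef c' = partial (N c) c'.
Proof.
move=> lec; rewrite -(partialE (n := maxn (N c) (N c')) lec) ?leq_maxl//.
by rewrite (partialE (lexx c')) ?leq_maxr.
Qed.

Let geom_wo : well_ordered (hsupport geom_coef).
Proof.
move=> C Cg [c0 Cc0].
have [||m [[Cm lem] minm]] :=
    hahn_wo (partial (N c0)) (C `&` [set c | c <= c0]).
- by move=> c [/Cg + lec]; rewrite /hsupport/= (geom_coefE lec).
- by exists c0; split=> //=.
exists m; split=> // x Cx; have [lex|/ltW lex] := leP x c0; first exact: minm.
exact: le_trans lem lex.
Qed.

Lemma geometric_inv : exists z : hahn, z * (1 - y) = 1.
Proof.
exists (Hahn geom_wo); apply: hahnP => c.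
have y1 : supp_ge 0 (1 - y).
  move=> a; rewrite hcoefB hcoef1; have [->//|_] := eqVneq a 0.
  by rewrite sub0r oppr_eq0 => /yv; apply: le_trans (ltW v_gt0).
rewrite mulrC (hmul_local (g' := partial (N c)) y1); last first.
  by move=> a; apply: geom_coefE.
rewrite /partial -opprB mulNr -subrX1 opprB hcoefB.
suff -> : (y ^+ N c) c = 0 by rewrite subr0.
by apply/eqP; apply: contraT => /(supp_geX yv); rewrite leNgt ltNv.
Qed.

End Geometric.

Lemma hsingleM a b x z : hsingle a x * hsingle b z = hsingle (a + b) (x * z).
Proof.
apply: hahnP => c; rewrite hcoefM (@hmul_coefE [:: a]) //.
  rewrite big_seq1 /= /hsingle_coef eqxx.
  rewrite (_ : (c - a == b) = (c == a + b)) ?mulrA//; last first.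
    by rewrite subr_eq addrC.
  by case: eqP => // _; rewrite mulr0.
move=> u; rewrite /= /hsingle_coef inE; have [//|_] := eqVneq u a.
by rewrite mul0r eqxx.
Qed.

Lemma hcoefMsingle a x f c : (hsingle a x * f) c = x * f (c - a).
Proof.
rewrite hcoefM (@hmul_coefE [:: a]) //.
  by rewrite big_seq1 /= /hsingle_coef eqxx.
move=> u; rewrite /= /hsingle_coef inE; have [//|_] := eqVneq u a.
by rewrite mul0r eqxx.
Qed.

Lemma hinv_exists f : f != 0 -> exists z : hahn, z * f = 1.
Proof.
move=> f0; have [|m [fm lem]] := hahn_wo f _ (@subset_refl _ _).
  apply/set0P; apply: contra_neq f0 => f0; apply: hahnP => a.
  rewrite hcoef0; apply/eqP; apply: contraT => fa.
  by have : hsupport f a by []; rewrite f0.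
rewrite /hsupport/= in fm.
pose u := hsingle (- m) (f m)^-1; pose y := 1 - u * f.
have [y0|/set0P ynz] := eqVneq (hsupport y) set0.
  exists u; apply/eqP; rewrite eq_sym -subr_eq0; apply/eqP/hahnP => a.
  rewrite hcoef0; apply/eqP; apply: contraT => ya.
  by have : hsupport y a by []; rewrite y0.
have [v [yv minv]] := hahn_wo y _ (@subset_refl _ _) ynz.
have v_gt0 : 0 < v.
  have : y v != 0 by [].
  rewrite hcoefB hcoef1 hcoefMsingle opprK.
  have [->|v0] := eqVneq v 0; first by rewrite add0r mulVf// subrr eqxx.
  rewrite sub0r oppr_eq0 mulf_eq0 negb_or => /andP[_ /lem].
  by rewrite -subr_ge0 addrK le0r (negPf v0).
have [z] := geometric_inv v_gt0 (minv : supp_ge v y).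
by rewrite /y opprB addrC subrK mulrA => zuf; exists (z * u).
Qed.

Definition hinv f : hahn := xget 0 [set z | z * f = 1].

Fact hmulV f : f != 0 -> hinv f * f = 1.
Proof. by move=> /hinv_exists ex; exact: (xgetPex 0 ex). Qed.

Fact hinv0 : hinv 0 = 0.
Proof.
by apply: xgetPN => z /eqP; rewrite mulr0 eq_sym oner_eq0.
Qed.

HB.instance Definition _ := GRing.ComNzRing_isField.Build hahn hmulV hinv0.

Definition hconst (x : K) : hahn := hsingle 0 x.

Fact hconst_is_zmod_morphism : zmod_morphism hconst.
Proof.
move=> x z; apply: hahnP => a; rewrite hcoefB /= /hsingle_coef.
by case: eqP; rewrite // subrr.
Qed.

Fact hconst_is_monoid_morphism : monoid_morphism hconst.
Proof. by split=> // x z; rewrite /hconst hsingleM addr0. Qed.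

HB.instance Definition _ := GRing.isZmodMorphism.Build K hahn hconst
  hconst_is_zmod_morphism.
HB.instance Definition _ := GRing.isMonoidMorphism.Build K hahn hconst
  hconst_is_monoid_morphism.

Lemma hsingleX a n : hsingle a 1 ^+ n = hsingle (a *+ n) 1.
Proof.
elim: n => [|n IHn]; first by rewrite expr0 mulr0n.
by rewrite exprS IHn hsingleM mulr1 mulrS.
Qed.

Definition hval f : \bar rat :=
  if f == 0 then +oo%E else (xget 0 (least (hsupport f)))%:E.

Lemma lt_hvalP (r : rat) f :
  (r%:E < hval f)%E <-> (forall a, f a != 0 -> r < a).
Proof.
rewrite /hval; have [->|f0] := eqVneq f 0.
  by split=> [_ a|_]; rewrite ?ltry// hcoef0 eqxx.
have : least (hsupport f) (xget 0 (least (hsupport f))).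
  apply: xgetPex; apply: (hahn_wo f _ (@subset_refl _ _)); apply/set0P.
  apply: contra_neq f0 => f0; apply: hahnP => a.
  rewrite hcoef0; apply/eqP; apply: contraT => fa.
  by have : hsupport f a by []; rewrite f0.
move: (xget _ _) => m [fm lem]; rewrite lte_fin; split=> [ltrm a fa|]; last exact.
by apply: lt_le_trans ltrm _; apply: lem.
Qed.

(* contains 0, as hval 0 = +oo *)
Definition hahn_pos : set hahn := [set f | (0 < hval f)%E].

(* the valuation topology: balls are [v (g - f) > r] *)
Definition hahn_nbhs f : set_system hahn :=
  filter_from [set: rat] (fun r => [set g | (r%:E < hval (g - f)%R)%E]).

HB.instance Definition _ := hasNbhs.Build hahn hahn_nbhs.

Fact hahn_nbhs_filter f : ProperFilter (nbhs f).
Proof.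
apply: filter_from_proper; last first.
  by move=> r _; exists f; rewrite /= subrr /hval eqxx ltry.
apply: filter_from_filter; first by exists 0.
move=> r s _ _; exists (Num.max r s) => // g /= /lt_hvalP ltg.
by split; apply/lt_hvalP => a /ltg; rewrite gt_max => /andP[].
Qed.

Fact hahn_nbhs_singleton f (A : set hahn) : nbhs f A -> A f.
Proof. by move=> [r _]; apply; rewrite /= subrr /hval eqxx ltry. Qed.

Fact hahn_nbhs_nbhs f (A : set hahn) : nbhs f A -> nbhs f (nbhs^~ A).
Proof.
move=> [r _ rA]; exists r => // g /= /lt_hvalP rg.
exists r => // h /= /lt_hvalP rh; apply: rA; apply/lt_hvalP => a.
rewrite (_ : h - f = (h - g) + (g - f)); last by rewrite addrA subrK.
rewrite hcoefD; have [->|/rh //] := eqVneq ((h - g) a) 0.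
by rewrite add0r => /rg.
Qed.

HB.instance Definition _ := Nbhs_isNbhsTopological.Build hahn
  hahn_nbhs_filter hahn_nbhs_singleton hahn_nbhs_nbhs.

End HahnSeries.

Arguments hahn_pos : clear implicits.

(* k(t) as a subfield of K((t^Q)), for a subfield [iota : k -> K]. *)
Section Embedding.
Variables (k K : fieldType) (iota : {rmorphism k -> K}).

Definition hahn_of_poly (P : {poly k}) : hahn K :=
  (map_poly (@hconst K \o iota) P).[hsingle 1 1].

Fact hahn_of_poly_is_zmod_morphism : zmod_morphism hahn_of_poly.
Proof. by move=> P Q; rewrite /hahn_of_poly rmorphB hornerD hornerN. Qed.

Fact hahn_of_poly_is_monoid_morphism : monoid_morphism hahn_of_poly.
Proof.
by split=> [|P Q]; rewrite /hahn_of_poly ?rmorph1 ?hornerC// rmorphM hornerM.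
Qed.

HB.instance Definition _ := GRing.isZmodMorphism.Build {poly k} (hahn K)
  hahn_of_poly hahn_of_poly_is_zmod_morphism.
HB.instance Definition _ := GRing.isMonoidMorphism.Build {poly k} (hahn K)
  hahn_of_poly hahn_of_poly_is_monoid_morphism.

Lemma hcoef_hahn_of_poly P (n : nat) : hahn_of_poly P n%:R = iota P`_n.
Proof.
rewrite /hahn_of_poly horner_coef size_map_poly hcoef_sum.
transitivity (\sum_(i < size P | i == n :> nat) iota P`_i).
  rewrite [RHS]big_mkcond; apply: eq_bigr => i _.
  rewrite coef_map hsingleX.
  rewrite [LHS](hcoefMsingle 0 (iota P`_i)) subr0 /= /hsingle_coef eqr_nat eq_sym.
  by case: eqP; rewrite ?mulr1 ?mulr0.
have [ltn|len] := ltnP n (size P).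
  by rewrite (big_pred1 (Ordinal ltn)).
rewrite big1 ?nth_default ?rmorph0// => i /eqP E.
by move: len; rewrite leqNgt -E ltn_ord.
Qed.

Lemma hahn_of_poly_eq0 P : (hahn_of_poly P == 0) = (P == 0).
Proof.
apply/eqP/eqP => [P0|->]; last exact: rmorph0.
apply/polyP => n; rewrite coef0; apply: (fmorph_inj iota).
by rewrite -hcoef_hahn_of_poly P0 hcoef0 rmorph0.
Qed.

Definition hahn_of_frac (x : {fraction {poly k}}) : hahn K :=
  hahn_of_poly \n_(repr x) / hahn_of_poly \d_(repr x).

Let fracE (x : {fraction {poly k}}) :
  x = tofrac \n_(repr x) / tofrac \d_(repr x).
Proof.
apply: (canRL (mulfK _)); first by rewrite tofrac_eq0 denom_ratioP.
unlock FracField.tofrac; rewrite -{1}[x]reprK -[LHS]FracField.pi_mul.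
apply/eqmodP; rewrite /= FracField.equivfE /FracField.mulf /=.
have d0 := denom_ratioP (repr x).
rewrite !numden_Ratio ?mulf_neq0 ?oner_neq0 ?denom_ratioP // !mulr1.
by rewrite mulrC.
Qed.

Lemma hahn_of_fracE P Q : Q != 0 ->
  hahn_of_frac (tofrac P / tofrac Q) = hahn_of_poly P / hahn_of_poly Q.
Proof.
move=> Q0; set x := _ / _; rewrite /hahn_of_frac.
apply/eqP; rewrite eqr_div ?hahn_of_poly_eq0 ?denom_ratioP// -!rmorphM/=.
apply/eqP; congr hahn_of_poly; apply/eqP; rewrite -tofrac_eq !rmorphM/=.
rewrite -eqr_div ?tofrac_eq0 ?denom_ratioP//.
by rewrite -(fracE x).
Qed.

Let fracP (x : {fraction {poly k}}) :
  exists P Q : {poly k}, Q != 0 /\ x = tofrac P / tofrac Q.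
Proof.
by exists \n_(repr x), \d_(repr x); split; [exact: denom_ratioP|exact: fracE].
Qed.

Fact hahn_of_frac_is_zmod_morphism : zmod_morphism hahn_of_frac.
Proof.
move=> x y; have [P [Q [Q0 ->]]] := fracP x; have [S [T [T0 ->]]] := fracP y.
rewrite -mulNr -(rmorphN (@FracField.tofrac _)) addf_div ?tofrac_eq0//.
rewrite -!(rmorphM (@FracField.tofrac _)) -(rmorphD (@FracField.tofrac _)).
rewrite !hahn_of_fracE ?mulf_neq0// -mulNr -(rmorphN hahn_of_poly).
rewrite addf_div ?hahn_of_poly_eq0//.
by rewrite -!(rmorphM hahn_of_poly) -(rmorphD hahn_of_poly).
Qed.

Fact hahn_of_frac_is_monoid_morphism : monoid_morphism hahn_of_frac.
Proof.
split=> [|x y].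
  rewrite -[1 in LHS]divr1 -(rmorph1 (@FracField.tofrac {poly k})).
  by rewrite hahn_of_fracE ?oner_neq0// rmorph1 divr1.
have [P [Q [Q0 ->]]] := fracP x; have [S [T [T0 ->]]] := fracP y.
rewrite mulf_div -!(rmorphM (@FracField.tofrac _)) !hahn_of_fracE ?mulf_neq0//.
by rewrite mulf_div -!(rmorphM hahn_of_poly).
Qed.

HB.instance Definition _ := GRing.isZmodMorphism.Build
  {fraction {poly k}} (hahn K) hahn_of_frac hahn_of_frac_is_zmod_morphism.
HB.instance Definition _ := GRing.isMonoidMorphism.Build
  {fraction {poly k}} (hahn K) hahn_of_frac hahn_of_frac_is_monoid_morphism.

End Embedding.

Section PowerSeries.
Variable R : comNzRingType.

Record fps := FPS { fcoef :> nat -> R }.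
Implicit Types F G H : fps.

Lemma fpsP F G : fcoef F =1 fcoef G -> F = G.
Proof. by case: F G => [F] [G] /= /funext ->. Qed.

HB.instance Definition _ := gen_eqMixin fps.
HB.instance Definition _ := gen_choiceMixin fps.

Definition fps_of_poly (q : {poly R}) : fps := FPS (fun i => q`_i).

Definition fps_add F G := FPS (fun i => F i + G i).
Definition fps_opp F := FPS (fun i => - F i).
Definition fps_mul F G := FPS (fun n => \sum_(i < n.+1) F i * G (n - i)%N).

Fact fps_addA : associative fps_add.
Proof. by move=> F G H; apply: fpsP => i /=; rewrite addrA. Qed.
Fact fps_addC : commutative fps_add.
Proof. by move=> F G; apply: fpsP => i /=; rewrite addrC. Qed.
Fact fps_add0 : left_id (fps_of_poly 0) fps_add.
Proof. by move=> F; apply: fpsP => i /=; rewrite coef0 add0r. Qed.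
Fact fps_addN : left_inverse (fps_of_poly 0) fps_opp fps_add.
Proof. by move=> F; apply: fpsP => i /=; rewrite coef0 addNr. Qed.

HB.instance Definition _ :=
  GRing.isZmodule.Build fps fps_addA fps_addC fps_add0 fps_addN.

Let trunc n F : {poly R} := \poly_(i < n.+1) F i.

Let fps_mulE n m F G : (m <= n)%N ->
  fps_mul F G m = (trunc n F * trunc n G)`_m.
Proof.
move=> lemn; rewrite coefM /fps_mul [LHS]/=; apply: eq_bigr => i _.
have lein : (i <= n)%N by apply: leq_trans lemn; rewrite -ltnS ltn_ord.
have lemin : (m - i <= n)%N by apply: leq_trans (leq_subr _ _) lemn.
by rewrite [X in _ = X * _]coef_poly [X in _ = _ * X]coef_poly !ltnS lein lemin.
Qed.

Let truncM n F G m : (m <= n)%N ->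
  (trunc n (fps_mul F G))`_m = (trunc n F * trunc n G)`_m.
Proof. by move=> lemn; rewrite coef_poly ltnS lemn (fps_mulE _ _ lemn). Qed.

Fact fps_mulC : commutative fps_mul.
Proof. by move=> F G; apply: fpsP => n; rewrite !(fps_mulE _ _ (leqnn n)) mulrC. Qed.

Fact fps_mulA : associative fps_mul.
Proof.
move=> F G H; apply: fpsP => n; rewrite !(fps_mulE _ _ (leqnn n)).
transitivity ((trunc n F * (trunc n G * trunc n H))`_n).
  rewrite !coefM; apply: eq_bigr => i _.
  by rewrite truncM ?leq_subr.
rewrite mulrA !coefM; apply: eq_bigr => i _.
by rewrite truncM // -ltnS.
Qed.

Fact fps_mul1 : left_id (fps_of_poly 1) fps_mul.
Proof.
move=> F; apply: fpsP => n /=; rewrite big_ord_recl subn0 coef1 mul1r.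
by rewrite big1 ?addr0// => i _; rewrite coef1 mul0r.
Qed.

Fact fps_mulD : left_distributive fps_mul fps_add.
Proof.
move=> F G H; apply: fpsP => n /=; rewrite -big_split.
by apply: eq_bigr => i _; rewrite /= mulrDl.
Qed.

Fact fps_1_neq0 : fps_of_poly 1 != fps_of_poly 0.
Proof.
apply/eqP => /(congr1 (fun F => fcoef F 0%N)) /eqP.
by rewrite /= coef0 coef1 oner_eq0.
Qed.

HB.instance Definition _ := GRing.Zmodule_isComNzRing.Build fps
  fps_mulA fps_mulC fps_mul1 fps_mulD fps_1_neq0.

Definition fps_unit : {pred fps} := fun F => `[< exists G, G * F = 1 >].

Definition fps_inv F : fps := xget F [set G | G * F = 1].

Fact fps_mulV : {in fps_unit, left_inverse 1 fps_inv *%R}.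
Proof. by move=> F /asboolP ex; exact: (xgetPex F ex). Qed.

Fact fps_unitPl F G : G * F = 1 -> fps_unit F.
Proof. by move=> GF; apply/asboolP; exists G. Qed.

Fact fps_inv_out : {in [predC fps_unit], fps_inv =1 id}.
Proof.
move=> F /asboolPn nex; apply: xgetPN => G GF; apply: nex; by exists G.
Qed.

HB.instance Definition _ := GRing.ComNzRing_hasMulInverse.Build fps
  fps_mulV fps_unitPl fps_inv_out.

Lemma fcoefM F G n : (F * G) n = \sum_(i < n.+1) F i * G (n - i)%N.
Proof. by []. Qed.

Fact fps_of_poly_is_zmod_morphism : zmod_morphism fps_of_poly.
Proof. by move=> q r; apply: fpsP => n /=; rewrite coefB. Qed.

Fact fps_of_poly_is_monoid_morphism : monoid_morphism fps_of_poly.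
Proof. by split=> // q r; apply: fpsP => n; rewrite fcoefM /= coefM. Qed.

HB.instance Definition _ := GRing.isZmodMorphism.Build {poly R} fps fps_of_poly
  fps_of_poly_is_zmod_morphism.
HB.instance Definition _ := GRing.isMonoidMorphism.Build {poly R} fps fps_of_poly
  fps_of_poly_is_monoid_morphism.

(* The series sum_n a_n x^(b n), for strictly increasing b: then b n = m
   forces n <= m, and at most one n contributes to the coefficient of x^m. *)
Definition lacunary (b : nat -> nat) (a : nat -> R) : fps :=
  FPS (fun m => \sum_(n < m.+1 | b n == m) a n).

Lemma lacunary_coef b a n : {homo b : i j / (i < j)%N} -> lacunary b a (b n) = a n.
Proof.
move=> b_incr; have le_b i : (i <= b i)%N.
  elim: i => // i IHi; exact: leq_ltn_trans IHi (b_incr _ _ (ltnSn i)).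
rewrite /= (big_pred1 (Ordinal (le_b n : (n < (b n).+1)%N))) // => i /=.
by rewrite (inj_eq (incn_inj (leq_mono b_incr))).
Qed.

Lemma lacunary_coef0 b a m : (forall n, b n <> m) -> lacunary b a m = 0.
Proof. by move=> nb; rewrite /= big1// => n /eqP /nb. Qed.

End PowerSeries.

Section Evaluation.
Variables (k K : fieldType) (iota : {rmorphism k -> K}).
Implicit Types (F : fps {poly k}) (lambda l : hahn K).

Definition partial_sum F lambda (n : nat) : hahn K :=
  \sum_(i < n) hahn_of_poly iota (F i) * lambda ^+ i.

(* [F(lambda) = l]: no default value is used when the series diverges *)
Definition fps_value F lambda l : Prop :=
  partial_sum F lambda n @[n --> \oo] --> l.

Definition fps_root F lambda : Prop := fps_value F lambda 0.

End Evaluation.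

(* Main.v *)
(* Let g = f / x. The Hahn series field is spherically complete, with
   algebraically closed residue field and divisible value group, so a power
   series with coefficients in its valuation ring, one of them a unit, and with
   constant term of positive valuation has a root of positive valuation: at a
   non-root x the Newton polygon of the Taylor expansion gives x' with
   v(g(x')) > v(g(x)), and Zorn's lemma on nested balls concludes. The root
   lambda of g is nonzero because a_0 <> 0.
   If lambda were algebraic over F_p(t), Liouville's inequality would bound the
   valuation of a nonzero partial sum Q_N(lambda), of x-degree b(N), by a
   constant times b(N); but this valuation is at least b(N+1) v(lambda), so
   Q_N(lambda) = 0 for all large N, although consecutive partial sums differ by
   a nonzero term a_n lambda^b(n). Finally, if f = q u with u a unit, then
   q(lambda) = 0, which would make lambda algebraic. *)
Require Import Defs.
From HB Require Import structures.
From mathcomp Require Import all_boot all_order all_algebra.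
From mathcomp Require Import boolp classical_sets functions cardinality fsbigop.
From mathcomp Require Import reals constructive_ereal topology normedtype.
From mathcomp Require Import zify.

Set Implicit Arguments.
Unset Strict Implicit.
Unset Printing Implicit Defensive.

Import Order.TTheory GRing.Theory Num.Theory.
Import numFieldNormedType.Exports.
Local Open Scope classical_set_scope.
Local Open Scope ring_scope.

Local Arguments hval {K} f%_ring_scope.

(** * Valuation bounds and the ultrametric inequality *)

Section Valuation.
Variable K : fieldType.
Implicit Types f g x y z : hahn K.

Lemma hval_fin f : f != 0 ->
  exists m, [/\ hval f = m%:E, f m != 0 & supp_ge m f].
Proof.
move=> f0; have : least (hsupport f) (xget 0 (least (hsupport f))).
  apply: xgetPex; apply: (hahn_wo (@subset_refl _ (hsupport f))); apply/set0P.
  apply: contra_neq f0 => f0; apply: hahnP => a; rewrite hcoef0.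
  apply/eqP; apply: contraT => fa.
  by have : hsupport f a by []; rewrite f0.
by case=> fm lem; exists (xget 0 (least (hsupport f))); rewrite /hval (negPf f0).
Qed.

Lemma le_hvalP (r : rat) f : (r%:E <= hval f)%E <-> supp_ge r f.
Proof.
have [->|f0] := eqVneq f 0.
  by rewrite /hval eqxx leey; split=> // _ a; rewrite hcoef0 eqxx.
have [m [-> fm lem]] := hval_fin f0.
rewrite lee_fin; split=> [lerm a /lem|]; first exact: le_trans.
exact.
Qed.

Lemma hval_pinfty f : hval f = +oo%E -> f = 0.
Proof. by have [//|/hval_fin[m [-> _ _]]] := eqVneq f 0. Qed.

Lemma hvalB x y : hval (x - y) = hval (y - x).
Proof.
suff le z : (hval z <= hval (- z))%E.
  by apply/le_anti/andP; split; rewrite -[X in (_ <= hval X)%E]opprB le.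
have [->|/hval_fin[m [-> _ lem]]] := eqVneq z 0; first by rewrite oppr0.
by apply/le_hvalP => a; rewrite hcoefN oppr_eq0 => /lem.
Qed.

Lemma supp_geD r f g : supp_ge r f -> supp_ge r g -> supp_ge r (f + g).
Proof.
move=> rf rg a; rewrite hcoefD; have [->|/rf //] := eqVneq (f a) 0.
by rewrite add0r => /rg.
Qed.

Lemma supp_geN r f : supp_ge r f -> supp_ge r (- f).
Proof. by move=> rf a; rewrite hcoefN oppr_eq0 => /rf. Qed.

Lemma supp_geB r f g : supp_ge r f -> supp_ge r g -> supp_ge r (f - g).
Proof. by move=> rf rg; apply: supp_geD => //; apply: supp_geN. Qed.

Lemma supp_ge_le r s f : r <= s -> supp_ge s f -> supp_ge r f.
Proof. by move=> lers sf a /sf; apply: le_trans. Qed.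

Lemma supp_ge0 r : supp_ge r (0 : hahn K).
Proof. by move=> a; rewrite hcoef0 eqxx. Qed.

Lemma supp_ge_sum r (I : Type) (s : seq I) (P : pred I) (F : I -> hahn K) :
  (forall i, P i -> supp_ge r (F i)) -> supp_ge r (\sum_(i <- s | P i) F i).
Proof.
move=> rF; elim/big_rec: _ => [|i f /rF]; [exact: supp_ge0|exact: supp_geD].
Qed.

Lemma supp_ge_eq0 f : (forall r, supp_ge r f) -> f = 0.
Proof.
move=> h; apply/eqP; apply: contraT => /hval_fin[m [_ fm _]].
by have := h (m + 1) m fm; rewrite gerDl ler10.
Qed.

Lemma hcoef_supp_ge r f a : supp_ge r f -> a < r -> f a = 0.
Proof. by move=> rf ltar; apply/eqP; apply: contraT => /rf; rewrite leNgt ltar. Qed.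

(** The ultrametric inequality. The bound [e] is extended because it gets instantiated by valuations
    of differences, which may be infinite. *)
Lemma hval_trans (e : \bar rat) y x z :
  (e <= hval (x - y) -> e <= hval (y - z) -> e <= hval (x - z))%E.
Proof.
have ->: x - z = (x - y) + (y - z) by rewrite addrA subrK.
case: e => [r||].
- by move=> /le_hvalP rx /le_hvalP rz; apply/le_hvalP; apply: supp_geD.
- rewrite !leye_eq => /eqP/hval_pinfty -> /eqP/hval_pinfty ->.
  by rewrite addr0 /hval eqxx.
by move=> _ _; rewrite leNye.
Qed.

End Valuation.

(** * Spherical completeness and existence of roots by Zorn's lemma *)

Section RootPrinciple.
Variable K : fieldType.
Implicit Types x y z w : hahn K.

(** The second hypothesis makes each [B x] a ball centred at [x]. If the chain has a smallest ball,
    its centre works; otherwise a common point is glued together coefficient by coefficient. *)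
Lemma spherically_complete (C : set (hahn K)) (B : hahn K -> set (hahn K)) :
  (forall x, B x x) ->
  (forall x y z, B x y -> (hval (y - x) <= hval (z - x))%E -> B x z) ->
  total_on C (fun x y => B y `<=` B x) ->
  exists y, forall x, C x -> B x y.
Proof.
move=> Bxx ballB chC.
have [[x Cx minx]|nmin] := pselect (exists2 x, C x & forall x', C x' -> B x `<=` B x').
  by exists x => x' /minx; apply.
have smaller x : C x -> exists x' w, [/\ C x', B x' `<=` B x, B x w & ~ B x' w].
  move=> Cx; apply: contrapT => nex; apply: nmin; exists x => // x' Cx' w Bw.
  apply: contrapT => nBw; apply: nex; exists x', w; split=> //.
  by case: (chC x x' Cx Cx') => // /(_ w Bw) /nBw.
(* All points of [B x] agree with the centre up to exponent [a]. Nestedness makes the prescribed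
   coefficients compatible; where no ball prescribes one, [y0] takes the default 0. *)
pose fixes (a : rat) x := C x /\ forall z, B x z -> forall c, c <= a -> z c = x c.
have fixesE a x x' c : fixes a x -> fixes a x' -> c <= a -> x c = x' c.
  move=> [Cx fx] [Cx' fx'] leca.
  by case: (chC x x' Cx Cx') => sub; [rewrite (fx x')//|rewrite (fx' x)//]; exact: sub.
pose y0 a := hcoef (xget 0 (fixes a)) a.
have y0E a x c : fixes a x -> c <= a -> y0 c = x c.
  move=> fax leca; have fcx : fixes c x.
    by case: fax => Cx fx; split=> // z Bz d ledc; apply: fx => //; exact: le_trans leca.
  by apply: (fixesE c) => //; apply: xgetPex; exists x.
(* Below any exponent of its support, [y0] coincides with a single Hahn series. *)
have wo0 : well_ordered (hsupport y0).
  move=> D Dy [a Da].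
  have [x fax] : exists x, fixes a x.
    apply: contrapT => /forallNP nf; have := Dy a Da; rewrite /hsupport/= /y0.
    by rewrite xgetPN// hcoef0 eqxx.
  have [||m [[Dm lema] minm]] := @hahn_wo _ x (D `&` [set c | c <= a]).
  - by move=> c [/Dy + leca]; rewrite /hsupport/= (y0E a x).
  - by exists a; split=> //=.
  exists m; split=> // c Dc; have [leca|/ltW leac] := leP c a; first exact: minm.
  exact: le_trans leac.
exists (Hahn wo0) => x Cx; have [x' [w [Cx' sub Bw nBw]]] := smaller x Cx.
(* The point [w] of [B x] outside [B x'] is farther from [x'] than all of [B x'], so coefficients up
   to [hval (w - x')] are fixed on [B x']. The glued series is then at least as close to [x'] as
   [w], which keeps it in [B x]. *)
have ltB z : B x' z -> (hval (w - x') < hval (z - x'))%E.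
  by move=> Bz; rewrite ltNge; apply/negP => le; apply: nBw; exact: ballB le.
have [a Ea] : exists a, hval (w - x') = a%:E.
  have [/subr0_eq E|/hval_fin[m [-> _ _]]] := eqVneq (w - x') 0; last by exists m.
  by case: nBw; rewrite E.
have fax : fixes a x'.
  split=> // z /ltB; rewrite Ea => /lt_hvalP lt c leca.
  apply/subr0_eq; rewrite -hcoefB; apply/eqP; apply: contraT => /lt.
  by rewrite ltNge leca.
have leyw : (hval (w - x') <= hval (Hahn wo0 - x'))%E.
  rewrite Ea; apply/ltW/lt_hvalP => c; rewrite hcoefB /= ltNge; apply: contraNN.
  by move=> leca; rewrite (y0E a x')// subrr.
have Bx' : B x x' by apply: sub.
have : (Order.min (hval (w - x)) (hval (x' - x)) <= hval (Hahn wo0 - x))%E.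
  apply: (hval_trans (y := x')); last by rewrite ge_min lexx orbT.
  apply: le_trans leyw; apply: (hval_trans (y := x)).
    by rewrite ge_min lexx.
  by rewrite [hval (x - x')]hvalB ge_min lexx orbT.
by rewrite ge_min => /orP[]; exact: ballB.
Qed.

(* [B x] is the largest ball around [x] on which [f] is at least as small as at
   [x]; the centre of a minimal such ball, which exists by Zorn's lemma, is a
   root. *)
Lemma root_of_improvable (f : hahn K -> hahn K) :
  (forall x, f x != 0 -> exists2 x', (hval (f x) < hval (f x'))%E &
     forall z, (hval (x' - x) <= hval (z - x) -> hval (f x) <= hval (f z))%E) ->
  exists x, f x = 0.
Proof.
move=> improve.
pose B x := [set y | forall z, (hval (y - x) <= hval (z - x) ->
                                hval (f x) <= hval (f z))%E].
have Bxx x : B x x.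
  move=> z; rewrite subrr {1}/hval eqxx leye_eq => /eqP/hval_pinfty/subr0_eq ->.
  exact: lexx.
have ballB x y z : B x y -> (hval (y - x) <= hval (z - x))%E -> B x z.
  by move=> Bxy le w lew; apply: Bxy; exact: le_trans lew.
have nestB x y : B x y -> B y `<=` B x.
  move=> Bxy z Byz w lew; have [leyw|ltwy] := leP (hval (y - x)) (hval (w - x)).
    exact: Bxy.
  (* Now v(z - x) <= v(w - x) < v(y - x), so moving the centre from [x] to [y] keeps [w] at least as
     close as [z]. *)
  apply: le_trans (Bxy y (lexx _)) _; apply: Byz.
  have lezw : (hval (z - y) <= hval (w - x))%E.
    rewrite leNgt; apply/negP => ltwz.
    suff : (hval (w - x) < hval (w - x))%E by rewrite ltxx.
    apply: lt_le_trans lew.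
    apply: (@lt_le_trans _ _ (Order.min (hval (z - y)) (hval (y - x)))).
      by rewrite lt_min ltwz.
    by apply: (hval_trans (y := y)); rewrite ge_min lexx ?orbT.
  apply: le_trans lezw _; apply: (hval_trans (y := x)) => //.
  by rewrite [hval (x - y)]hvalB ltW.
pose R x y := `[< B y `<=` B x >].
have [||A chA|x maxx] := @ZL_preorder _ (0 : hahn K) R.
- by move=> x; apply/asboolP.
- by move=> y x z /asboolP xy /asboolP yz; apply/asboolP; exact: subset_trans xy.
- have [|y Ay] := @spherically_complete A B Bxx ballB.
    by move=> x y Ax Ay; case: (chA x y Ax Ay) => /asboolP; [left|right].
  by exists y => x /Ay Bxy; apply/asboolP; exact: nestB.
exists x; apply/eqP; apply: contraT => /improve[x' ltf Bxx'].
(* Maximality puts [x] back into the ball of the improved point [x'], so [f x] would be at least as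
   small as [f x']. *)
have : R x' x by apply: maxx; apply/asboolP; exact: nestB.
move=> /asboolP /(_ x (Bxx x)) /(_ x (lexx _)).
by rewrite leNgt ltf.
Qed.
End RootPrinciple.

(** * Valuations of polynomial values *)

Section Estimates.
Variable K : fieldType.
Implicit Types (P : {poly hahn K}) (x y z : hahn K).

Lemma hsingle_exp a (s : K) n : hsingle a s ^+ n = hsingle (a *+ n) (s ^+ n).
Proof.
elim: n => [|n IHn]; first by rewrite !expr0 mulr0n.
by rewrite exprS IHn hsingleM mulrS exprS.
Qed.

Lemma supp_ge_hsingle a (s : K) : supp_ge a (hsingle a s).
Proof.
move=> c /=; rewrite /hsingle_coef; have [-> //|_] := eqVneq c a.
by rewrite eqxx.
Qed.

Lemma supp_geMn r x n : supp_ge r x -> supp_ge r (x *+ n).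
Proof.
by move=> rx; elim: n => [|n IHn]; [exact: supp_ge0|rewrite mulrS; exact: supp_geD].
Qed.

Lemma supp_geM0 r s x y : supp_ge r x -> supp_ge 0 y -> s <= r -> supp_ge s (x * y).
Proof.
by move=> rx y0 /supp_ge_le; apply; rewrite -[r]addr0; exact: supp_geM.
Qed.

Lemma supp_ge_horner r P x : (forall i, supp_ge r P`_i) -> supp_ge 0 x -> supp_ge r P.[x].
Proof.
move=> rP x0; rewrite horner_coef; apply: supp_ge_sum => i _.
by apply: supp_geM0 (rP i) _ (lexx _); rewrite -[0](mul0rn _ i); exact: supp_geX.
Qed.

Lemma supp_ge_coef0_horner e P x : 0 < e -> (forall i, supp_ge 0 P`_i) ->
  supp_ge e x -> P.[x] 0 = P`_0 0.
Proof.
move=> e0 P0 ex; rewrite (horner_coef_wide _ (leqnSn (size P))) big_ord_recl expr0 mulr1.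
rewrite hcoefD hcoef_sum big1 ?addr0// => i _.
apply: (@hcoef_supp_ge _ e) => //; rewrite exprS mulrCA.
apply: (@supp_geM0 e) => //; apply: (@supp_geM0 0) => //.
by rewrite -[0](mul0rn _ i); apply: supp_geX; apply: supp_ge_le (ltW e0) ex.
Qed.

End Estimates.

(** * One step of Newton polygon approximation *)

Section NewtonStep.
Variable K : closedFieldType.
Implicit Types (P : {poly hahn K}) (x y z : hahn K).

(* The increment [y] has exponent [r], the largest slope
   [(g - v(c_j)) / j] over [1 <= j <= d], where [c_j] are the Taylor coefficients at
   [x]; its coefficient is a root of the residual polynomial. *)
Lemma newton_step P x (d : nat) (e g : rat) :
  (0 < d)%N -> (forall i, supp_ge 0 P`_i) -> P`_d 0 != 0 ->
  0 < e -> supp_ge e x -> 0 < g -> supp_ge g P.[x] ->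
  exists y r, [/\ g / d%:R <= r, supp_ge r y,
    (forall a, P.[x + y] a != 0 -> g < a) &
    forall z, supp_ge r z -> supp_ge g P.[x + z]].
Proof.
move=> d0 P0 Pd e0 ex g0 gP.
pose c j := P^`N(j).[x].
have x0 : supp_ge 0 x by apply: supp_ge_le (ltW e0) ex.
have coefN j i : supp_ge 0 (P^`N(j)`_i) by rewrite coef_nderivn; apply: supp_geMn.
have c0 j : supp_ge 0 (c j) by apply: supp_ge_horner.
have cd : c d 0 != 0.
  by rewrite (supp_ge_coef0_horner e0 (coefN d) ex) coef_nderivn addn0 binn mulr1n.
have gc0 : supp_ge g (c 0%N) by rewrite /c nderivn0.
pose slope (j : nat) := (g - fine (hval (c j.+1))) / j.+1%:R.
have fineE j : c j != 0 ->
    c j (fine (hval (c j))) != 0 /\ supp_ge (fine (hval (c j))) (c j).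
  by move=> /hval_fin[m [-> cm lem]].
have cdn0 : c d != 0 by apply: contraNneq cd => ->; rewrite hcoef0.
have predd : (d.-1 < d)%N by rewrite prednK.
pose jd := Ordinal predd.
have [|j0 cj0 maxj0] := @Order.TotalTheory.arg_maxP _ _ _ jd
  (fun j : 'I_d => c j.+1 != 0) (fun j : 'I_d => slope j) _.
  by rewrite /= prednK.
pose r := slope j0.
have ger : g / d%:R <= r.
  have := maxj0 jd; rewrite /= prednK// => /(_ cdn0); apply: le_trans.
  rewrite /slope /= prednK// ler_pM2r ?invr_gt0 ?ltr0n//.
  by rewrite lerDl oppr_ge0; apply: (fineE d cdn0).2.
have r0 : 0 < r by apply: lt_le_trans ger; rewrite divr_gt0// ltr0n.
have gcj j : supp_ge (g - r *+ j) (c j).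
  case: j => [|j]; first by rewrite mulr0n subr0.
  have [ltjd|ledj] := ltnP j d.
    have [->|cj] := eqVneq (c j.+1) 0; first exact: supp_ge0.
    apply: supp_ge_le (fineE _ cj).2; rewrite lerBlDr -lerBlDl -mulr_natr.
    rewrite -ler_pdivrMr ?ltr0n//; exact: (maxj0 (Ordinal ltjd)).
  (* Beyond index [d], v(c_j) >= 0 >= g - r j because r >= g / d. *)
  apply: supp_ge_le (c0 _); rewrite subr_le0.
  apply: le_trans (_ : r *+ d <= _).
    by rewrite -mulr_natr -ler_pdivrMr ?ltr0n.
  by apply: ler_wpMn2l; rewrite ?ltW// ltnW.
pose n := maxn (size P) d.+1.
have taylor z : P.[x + z] = \sum_(j < n) c j * z ^+ j.
  by apply: nderiv_taylor_wide; [exact: mulrC|exact: leq_maxl].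
(* The coefficient of t^g in P(x + s t^r) is [res.[s]]. At the maximising index, g - r j is exactly
   v(c_j), so [res] is not constant and has a root in the residue field. *)
pose res := \poly_(j < n) c j (g - r *+ j).
have [|s /rootP rs] := closed_rootP res _.
  rewrite neq_ltn; apply/orP; right.
  have : res`_j0.+1 != 0.
    rewrite coef_poly (leq_trans _ (leq_maxr _ _)) ?ltnS//.
    suff -> : g - r *+ j0.+1 = fine (hval (c j0.+1)) by apply: (fineE _ cj0).1.
    by rewrite /r /slope -mulr_natr divfK ?pnatr_eq0// subKr.
  by apply: contraR; rewrite -leqNgt => le; rewrite nth_default// (leq_trans le).
exists (hsingle r s), r; split=> //.
- exact: supp_ge_hsingle.
- move=> a; apply: contraR; rewrite -leNgt taylor hcoef_sum => leag; apply/eqP.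
  transitivity (\sum_(j < n) s ^+ j * c j (a - r *+ j)).
    by apply: eq_bigr => j _; rewrite hsingle_exp mulrC hcoefMsingle.
  have [->|neag] := eqVneq a g.
    by rewrite -[RHS]rs horner_poly; apply: eq_bigr => j _; rewrite mulrC.
  rewrite big1// => j _; rewrite (hcoef_supp_ge (gcj j)) ?mulr0//.
  by rewrite ltrD2r lt_neqAle neag.
move=> z rz; rewrite taylor; apply: supp_ge_sum => j _.
by rewrite -[g](subrK (r *+ j)); apply: supp_geM => //; exact: supp_geX.
Qed.
End NewtonStep.

(** * Completeness and values of power series *)

Section Completeness.
Variable K : fieldType.
Implicit Types (c : nat -> hahn K) (x y z : hahn K).

Lemma rat_archimedean (e r : rat) : 0 < e -> exists N, forall n, (N <= n)%N -> r < e *+ n.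
Proof.
move=> e0; exists (Num.bound `|r / e|) => n leNn; rewrite -mulr_natl -ltr_pdivrMr//.
apply: le_lt_trans (ler_norm _) _.
by apply: lt_le_trans (archi_boundP (normr_ge0 _)) _; rewrite ler_nat.
Qed.

Lemma hval_gt0P x : (0 < hval x)%E <-> exists2 e, 0 < e & supp_ge e x.
Proof.
split=> [x0|[e e0 /le_hvalP]]; last by apply: lt_le_trans; rewrite lte_fin.
have [->|/hval_fin[m [Em _ lem]]] := eqVneq x 0; first by exists 1 => //; exact: supp_ge0.
by exists m => //; rewrite Em lte_fin in x0.
Qed.

(** Along a Cauchy sequence each coefficient stabilises. *)
Lemma hahn_complete (u : nat -> hahn K) :
  (forall r, exists N, forall n, (N <= n)%N -> supp_ge r (u n - u N)) ->
  exists l, forall r, exists N, forall n, (N <= n)%N -> supp_ge r (l - u n).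
Proof.
move=> /choice[N NP].
have uE r n a : (N r <= n)%N -> a < r -> u n a = u (N r) a.
  move=> leNn ltar; apply/subr0_eq; rewrite -hcoefB.
  exact: hcoef_supp_ge (NP r n leNn) ltar.
(* From index [N r] on, only coefficients strictly below [r] are frozen; hence [a + 1]. *)
pose l0 a := u (N (a + 1)) a.
have l0E r n a : (N r <= n)%N -> a < r -> l0 a = u n a.
  move=> leNn ltar; rewrite /l0 (uE r n)// -(uE (a + 1) (maxn (N (a + 1)) (N r))).
  - by rewrite (uE r) ?leq_maxr.
  - exact: leq_maxl.
  - by rewrite ltrDl.
have wo0 : well_ordered (hsupport l0).
  move=> D Dl [a Da]; have lta (b : rat) : b <= a -> b < a + 1.
    by move=> /le_lt_trans; apply; rewrite ltrDl.
  have [||m [[Dm lema] minm]] := @hahn_wo _ (u (N (a + 1))) (D `&` [set b | b <= a]).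
  - by move=> b [/Dl + /lta ltb]; rewrite /hsupport/= (l0E (a + 1) (N (a + 1))).
  - by exists a; split=> //=.
  exists m; split=> // b Db; have [leba|/ltW leab] := leP b a; first exact: minm.
  exact: le_trans leab.
exists (Hahn wo0) => r; exists (N r) => n leNn a; rewrite hcoefB /= leNgt.
by apply: contraNN => ltar; rewrite (l0E r n)// subrr.
Qed.

Lemma supp_ge_poly_tail c x e m n : 0 < e -> (forall i, supp_ge 0 (c i)) ->
  supp_ge e x -> (n <= m)%N ->
  supp_ge (e *+ n) ((\poly_(i < m) c i).[x] - (\poly_(i < n) c i).[x]).
Proof.
move=> e0 c0 ex lenm; rewrite !horner_poly.
rewrite -!(big_mkord predT (fun i => c i * x ^+ i)) (big_cat_nat (n := n))//=.
rewrite addrAC subrr add0r big_seq_cond; apply: supp_ge_sum => i /andP[].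
rewrite mem_index_iota => /andP[leni _] _.
rewrite mulrC; apply: supp_geM0 (c0 i) _; first exact: supp_geX ex.
by apply: ler_wpMn2l; rewrite ?ltW.
Qed.

(** One limit serves every admissible [e]: it is built with one bound [d], and the tail estimate for
    another [e] passes to the limit. *)
Lemma series_value c x : (forall i, supp_ge 0 (c i)) -> (0 < hval x)%E ->
  exists l, forall e n, 0 < e -> supp_ge e x ->
    supp_ge (e *+ n) (l - (\poly_(i < n) c i).[x]).
Proof.
move=> c0 /hval_gt0P[d d0 dx].
have [|l lP] := @hahn_complete (fun n => (\poly_(i < n) c i).[x]).
  move=> r; have [N NP] := rat_archimedean r d0; exists N => n leNn.
  by apply: supp_ge_le (supp_ge_poly_tail d0 c0 dx leNn); rewrite ltW// NP.
exists l => e n e0 ex; have [N NP] := lP (e *+ n).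
rewrite -[l](subrK (\poly_(i < maxn N n) c i).[x]) -addrA.
apply: supp_geD; first by apply: NP; exact: leq_maxl.
by apply: supp_ge_poly_tail => //; exact: leq_maxr.
Qed.

End Completeness.

(** * Roots of power series over the valuation ring *)

Section PowerSeriesRoot.
Variable K : closedFieldType.
Implicit Types (c : nat -> hahn K) (x y z : hahn K).

(** Newton steps on long truncations feed the root principle. The conclusion bounds every
    truncation, a quantitative form of vanishing that the later estimates consume. *)
Lemma series_root c (d : nat) : (forall i, supp_ge 0 (c i)) -> (0 < d)%N ->
  c 0%N 0 = 0 -> c d 0 != 0 ->
  exists x e, [/\ 0 < e, supp_ge e x &
    forall n, supp_ge (e *+ n) (\poly_(i < n) c i).[x]].
Proof.
move=> c0 d0 c00 cd.
have /choice[V VP] x : exists l, (0 < hval x)%E -> forall e n, 0 < e ->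
    supp_ge e x -> supp_ge (e *+ n) (l - (\poly_(i < n) c i).[x]).
  have [/(series_value c0)[l lP]|] := boolP (0 < hval x)%E; first by exists l.
  by exists 0.
have V_gt0 x a : (0 < hval x)%E -> V x a != 0 -> 0 < a.
  move=> x0; have [e e0 ex] := (hval_gt0P x).1 x0.
  have := VP x x0 e 1%N e0 ex; rewrite horner_poly big_ord_recl big_ord0 addr0 mulr1.
  move=> /(_ a); rewrite hcoefB mulr1n; have [->|ca] := eqVneq (c 0%N a) 0.
    by rewrite subr0 => /[apply]; exact: lt_le_trans.
  rewrite lt_neqAle (c0 0%N) // andbT => _ _; by apply: contraNneq ca => <-; rewrite c00.
have val1 : hval (1 : hahn K) = 0%:E.
  have [m [-> + _]] := hval_fin (oner_neq0 (hahn K)).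
  by rewrite hcoef1; have [->//|_] := eqVneq m 0; rewrite eqxx.
(* The value 1 outside the maximal ideal makes [f] total and creates no root there; such points are
   improved by 0, where [f] has positive valuation. *)
pose f x := if (0 < hval x)%E then V x else 1.
have f_ge0 x : (0 <= hval (f x))%E.
  rewrite /f; case: ifP => [x0|_]; last by rewrite val1.
  by apply/ltW/lt_hvalP => a; exact: V_gt0.
have [x|x fx0] := root_of_improvable (f := f).
  rewrite {1 2 4}/f; case: ifP => [x0 Vx0|_ _]; last first.
    rewrite val1; have z0 : (0 < hval (0 : hahn K))%E by rewrite /hval eqxx ltry.
    by exists 0; rewrite // /f z0; apply/lt_hvalP => a; exact: V_gt0.
  have [e e0 ex] := (hval_gt0P x).1 x0.
  have [g [Eg Vg leg]] := hval_fin Vx0.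
  have g0 : 0 < g by apply: V_gt0 Vg.
  have gd : 0 < g / d%:R by rewrite divr_gt0// ltr0n.
  (* A lower bound for the valuations of [x] and of all points reached by the step. [N] makes
     truncation errors exceed [g] there, and keeps the unit coefficient of index [d]. *)
  pose rho := Num.min e (g / d%:R).
  have rho0 : 0 < rho by rewrite lt_min e0.
  have [N0 N0P] := rat_archimedean g rho0.
  pose N := maxn N0 d.+1; have ltgN : g < rho *+ N by apply: N0P; exact: leq_maxl.
  pose P := \poly_(i < N) c i.
  have P0 i : supp_ge 0 P`_i.
    by rewrite coef_poly; case: ifP => // _; exact: supp_ge0.
  have VB z : supp_ge rho z -> (0 < hval z)%E /\ supp_ge (rho *+ N) (V z - P.[z]).
    move=> rz; have z0 : (0 < hval z)%E by apply/hval_gt0P; exists rho.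
    by split=> //; apply: VP.
  have rhox : supp_ge rho x by apply: supp_ge_le ex; rewrite ge_min lexx.
  have Pd : P`_d 0 != 0 by rewrite coef_poly leq_maxr.
  have [|y [r [ger ry Py Pz]]] := newton_step d0 P0 Pd e0 ex g0.
    rewrite -[P.[x]](subKr (V x)); apply: supp_geB => //.
    by apply: supp_ge_le (VB x rhox).2; exact: ltW.
  have lerho z : supp_ge r z -> supp_ge rho (x + z).
    by move=> rz; apply: supp_geD => //; apply: supp_ge_le rz; rewrite ge_min ger orbT.
  exists (x + y).
    have [xy0 Vxy] := VB _ (lerho _ ry).
    rewrite /f xy0 Eg; apply/lt_hvalP => a; rewrite -[V _](subrK P.[x + y]) hcoefD.
    have [->|/Vxy lea _] := eqVneq ((V (x + y) - P.[x + y]) a) 0.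
      by rewrite add0r; exact: Py.
    exact: lt_le_trans ltgN lea.
  move=> z; rewrite addrAC subrr add0r => lez.
  have rz : supp_ge r (z - x).
    by apply/le_hvalP; apply: le_trans lez; apply/le_hvalP.
  have := lerho _ rz; rewrite addrC subrK => /VB[z0 Vz].
  rewrite /f z0 Eg; apply/le_hvalP; rewrite -[V z](subrK P.[z]).
  apply: supp_geD; first by apply: supp_ge_le Vz; exact: ltW.
  by rewrite -[z](subrK x) [_ + x]addrC; exact: Pz.
move: fx0; rewrite /f; case: ifP => [x0 Vx0|_ /eqP]; last by rewrite oner_eq0.
have [e e0 ex] := (hval_gt0P x).1 x0; exists x, e; split=> // n.
by rewrite -[_.[x]]opprK; apply: supp_geN; rewrite -sub0r -Vx0; exact: VP.
Qed.
End PowerSeriesRoot.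

(** * Degree bounds for determinants and resultants *)

Section DeterminantDegree.
Variable R : idomainType.

Lemma size_prod_bound (I : Type) (s : seq I) (F : I -> {poly R}) (w : I -> nat) :
  (forall i, size (F i) <= (w i).+1)%N ->
  (size (\prod_(i <- s) F i)%R <= (\sum_(i <- s) w i).+1)%N.
Proof.
move=> Fw; elim/big_rec2: _ => [|i m q _ IH]; first by rewrite size_poly1.
apply: leq_trans (size_polyMleq _ _) _; have := Fw i; lia.
Qed.

(** Each term of the Leibniz expansion takes one entry from every row. *)
Lemma size_det_bound n (M : 'M[{poly R}]_n) (w : 'I_n -> nat) :
  (forall i j, size (M i j) <= (w i).+1)%N ->
  (size (\det M) <= (\sum_i w i).+1)%N.
Proof.
move=> Mw; apply: leq_trans (size_sum _ _ _) _; apply/bigmax_leqP => s _.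
rewrite mulr_sign -size_polyN; case: ifP => _; rewrite ?opprK ?size_polyN.
  by apply: size_prod_bound.
by apply: size_prod_bound.
Qed.

Lemma size_resultant_bound (P Q : {poly {poly R}}) A B :
  (forall i, size (P`_i)%R <= A.+1)%N -> (forall i, size (Q`_i)%R <= B.+1)%N ->
  (size (resultant P Q) <= ((size Q).-1 * A + (size P).-1 * B).+1)%N.
Proof.
move=> PA QB.
pose w (i : 'I_((size Q).-1 + (size P).-1)) := if fintype.split i is inl _ then A else B.
have : (size (resultant P Q) <= (\sum_i w i).+1)%N.
  apply: size_det_bound => i j; rewrite /w.
  rewrite Sylvester_mxE.
  by case: (fintype.split i) => j0; case: (j0 <= j)%N;
    rewrite ?mulr1n ?mulr0n ?size_poly0.
rewrite big_split_ord /= /w.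
under eq_bigr do rewrite (unsplitK (inl _)).
under [X in (_ + X)%N]eq_bigr do rewrite (unsplitK (inr _)).
by rewrite !sum_nat_const !card_ord.
Qed.

End DeterminantDegree.

(** * Algebraicity over k(t) and Liouville's inequality *)

Section Liouville.
Variables (k K : fieldType) (iota : {rmorphism k -> K}).
Implicit Types (P Q M : {poly {poly k}}) (x : hahn K).

Local Notation hp := (hahn_of_poly iota).

Lemma hahn_of_poly_supp_ge (F : {poly k}) : supp_ge 0 (hp F).
Proof.
apply: supp_ge_horner => [i|]; last first.
  exact: supp_ge_le ler01 (@supp_ge_hsingle K 1 1).
by rewrite coef_map; apply: supp_ge_hsingle.
Qed.

Lemma hahn_of_poly_supp_bound (F : {poly k}) r :
  F != 0 -> supp_ge r (hp F) -> r <= (size F).-1%:R.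
Proof.
move=> F0; apply; rewrite hcoef_hahn_of_poly fmorph_eq0.
by rewrite -lead_coefE lead_coef_eq0.
Qed.

Lemma map_hahn_of_poly_eq0 P : (map_poly hp P == 0) = (P == 0).
Proof.
apply/eqP/eqP => [P0|->]; last exact: rmorph0.
apply/polyP => i; rewrite coef0; apply/eqP; rewrite -(hahn_of_poly_eq0 iota).
by rewrite -coef_map P0 coef0.
Qed.

Lemma hahn_of_frac_tofrac (F : {poly k}) : hahn_of_frac iota (FracField.tofrac F) = hp F.
Proof.
rewrite -[FracField.tofrac F]divr1 -(rmorph1 (@FracField.tofrac {poly k})).
by rewrite hahn_of_fracE ?oner_neq0// rmorph1 divr1.
Qed.

Lemma algebraicOver_frac x : algebraicOver (hahn_of_frac iota) x <->
  exists2 Q, Q != 0 & root (map_poly hp Q) x.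
Proof.
split=> [[q q0 qx]|[Q Q0 Qx]]; last first.
  exists (map_poly (@FracField.tofrac {poly k}) Q).
    apply: contra_neq Q0 => Q0; apply/polyP => i; rewrite coef0; apply/eqP.
    by rewrite -tofrac_eq0 -coef_map Q0 coef0.
  rewrite -map_poly_comp; congr (root _ x): Qx.
  by apply: eq_map_poly => F; rewrite /= hahn_of_frac_tofrac.
(* Denominators are cleared one coefficient at a time, [D] being their product. *)
have [D [Q [D0 DQ]]] : exists D Q, D != 0 /\
    hp D *: map_poly (hahn_of_frac iota) q = map_poly hp Q.
  elim/poly_ind: q {q0 qx} => [|q c [D [Q [D0 IH]]]].
    by exists 1, 0; rewrite oner_neq0 !rmorph0 scaler0.
  exists (D * \d_(repr c)), (\d_(repr c) *: Q * 'X + (D * \n_(repr c))%:P).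
  split; first by rewrite mulf_neq0 ?denom_ratioP.
  have d0 : hp \d_(repr c) != 0 by rewrite hahn_of_poly_eq0 denom_ratioP.
  rewrite !(rmorphD, rmorphM) /= !map_polyX !map_polyC /= map_polyZ /= -IH.
  rewrite scalerDr scalerAl scalerA [hp _ * hp D]mulrC; congr (_ + _).
  rewrite -mul_polyC -!polyCM; congr _%:P.
  by rewrite /hahn_of_frac -mulrA [hp \d_ _ * _]mulrC divfK.
exists Q.
  rewrite -map_hahn_of_poly_eq0 -DQ scaler_eq0 hahn_of_poly_eq0 (negPf D0) /=.
  by rewrite map_poly_eq0.
by rewrite -DQ rootE hornerZ (rootP qx) mulr0.
Qed.

(* For [Q] coprime to the minimal polynomial [M] of [x], the resultant of [M]
   and [Q] is a nonzero polynomial in [t], of controlled degree, and a multiple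
   of [Q(x)]. *)
Lemma liouville x : supp_ge 0 x -> algebraicOver (hahn_of_frac iota) x ->
  exists c : nat, forall Q B r, (1 < size Q)%N ->
    (forall i, size (Q`_i)%R <= B.+1)%N ->
    (map_poly hp Q).[x] != 0 -> supp_ge r (map_poly hp Q).[x] ->
    r <= (c * ((size Q).-1 + B))%:R.
Proof.
move=> x0 /algebraicOver_frac[M0 M00 M0x].
have exM : exists n, `[< exists2 M, M != 0 & root (map_poly hp M) x /\ size M = n >].
  by exists (size M0); apply/asboolP; exists M0.
have [_ /asboolP[M nzM [Mx <-]] minM'] := ex_minnP exM.
have minM M' : M' != 0 -> root (map_poly hp M') x -> (size M <= size M')%N.
  by move=> M'0 M'x; apply: minM'; apply/asboolP; exists M'.
have sM : (1 < size M)%N.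
  rewrite ltnNge; apply/negP => /size1_polyC EM; move: Mx nzM.
  by rewrite EM map_polyC rootC polyC_eq0 hahn_of_poly_eq0 => ->.
pose A := \max_(i < size M) size (M`_i)%R.
have MA i : (size (M`_i)%R <= A.+1)%N.
  have [lti|gei] := ltnP i (size M); last by rewrite nth_default// size_poly0.
  by apply: leqW; exact: (leq_bigmax (Ordinal lti)).
exists (A + (size M).-1)%N => Q B r sQ QB Qx rQ.
have res0 : resultant M Q != 0.
  (* Up to nonzero scalars of k[t], [G] divides both [M] and [Q]. If the cofactor of [G] in [M]
     vanishes at [x], it contradicts the minimal size of [M]; if [G] does, then Q(x) = 0. *)
  rewrite resultant_eq0 -leqNgt leqNgt; apply/negP => sG; set G := gcdp M Q in sG.
  have [[c U] /= c0 EM] := Pdiv.Idomain.dvdpP _ _ (dvdp_gcdl M Q).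
  have [[c' U'] /= c'0 EQ] := Pdiv.Idomain.dvdpP _ _ (dvdp_gcdr M Q).
  have U0 : U != 0.
    apply: contraNneq nzM => U0; move/eqP: EM.
    by rewrite U0 mul0r -mul_polyC mulf_eq0 polyC_eq0 (negPf c0).
  have : root (map_poly hp (U * G)) x.
    by rewrite -EM map_polyZ rootE hornerZ (rootP Mx) mulr0.
  rewrite rmorphM rootM => /orP[Ux|Gx].
    have G0 : G != 0 by rewrite -size_poly_gt0; apply: leq_trans sG.
    have sMUG : size M = (size U + size G).-1 by rewrite -size_mul// -EM size_scale.
    have := minM U U0 Ux; rewrite -size_poly_gt0 in U0.
    have arith (m u g : nat) :
        (0 < u -> 1 < g -> m = (u + g).-1 -> m <= u -> False)%N by lia.
    exact: arith U0 sG sMUG.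
  case/eqP: Qx; apply/eqP; have := congr1 (horner^~ x \o map_poly hp) EQ.
  rewrite /= map_polyZ hornerZ rmorphM hornerM (rootP Gx) mulr0 => /eqP.
  by rewrite mulf_eq0 hahn_of_poly_eq0 (negPf c'0).
have [[U V] _ /= EUV] := resultant_in_ideal sM sQ.
have rres : supp_ge r (hp (resultant M Q)).
  have -> : hp (resultant M Q) = (map_poly hp Q).[x] * (map_poly hp V).[x].
    have := congr1 (horner^~ x \o map_poly hp) EUV.
    rewrite /= map_polyC hornerC rmorphD !rmorphM hornerD !hornerM (rootP Mx).
    by rewrite mulr0 add0r mulrC.
  apply: supp_geM0 rQ _ (lexx _); apply: supp_ge_horner => // i.
  by rewrite coef_map; exact: hahn_of_poly_supp_ge.
apply: le_trans (hahn_of_poly_supp_bound res0 rres) _; rewrite ler_nat.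
have arith (s q m B' : nat) :
    (s <= (q * A + m * B').+1 -> s.-1 <= (A + m) * (q + B'))%N by nia.
exact: arith (size_resultant_bound MA QB).
Qed.

End Liouville.

(** * Partial sums, products and factorisations *)

Section PartialSums.
Variables (k K : fieldType) (iota : {rmorphism k -> K}).
Implicit Types (F G : fps {poly k}) (x : hahn K).

Local Notation hp := (hahn_of_poly iota).

Lemma partial_sumE F x n : partial_sum iota F x n = (\poly_(i < n) hp (F i)).[x].
Proof. by rewrite horner_poly. Qed.

Lemma partial_sumS F x n :
  partial_sum iota F x n.+1 = partial_sum iota F x n + hp (F n) * x ^+ n.
Proof. by rewrite /partial_sum big_ord_recr. Qed.

Lemma partial_sum_map F x n :
  partial_sum iota F x n = (map_poly hp (\poly_(i < n) F i)).[x].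
Proof.
rewrite partial_sumE; congr _.[x]; apply/polyP => i.
by rewrite coef_map !coef_poly; case: ifP => _ //; rewrite raddf0.
Qed.

Lemma supp_ge_partial_sum F x n : supp_ge 0 x -> supp_ge 0 (partial_sum iota F x n).
Proof.
move=> x0; rewrite partial_sum_map; apply: supp_ge_horner => // i.
by rewrite coef_map; exact: hahn_of_poly_supp_ge.
Qed.

Lemma supp_ge_low_coefs0 (P : {poly {poly k}}) x e n : 0 < e -> supp_ge e x ->
  (forall i, (i < n)%N -> P`_i = 0) -> supp_ge (e *+ n) (map_poly hp P).[x].
Proof.
move=> e0 ex P0; rewrite horner_coef; apply: supp_ge_sum => i _; rewrite coef_map /=.
have [/P0 ->|leni] := ltnP i n; first by rewrite rmorph0 mul0r; exact: supp_ge0.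
rewrite mulrC; apply: (@supp_geM0 _ (e *+ i)).
- exact: supp_geX.
- exact: hahn_of_poly_supp_ge.
- by apply: ler_wpMn2l; rewrite ?ltW.
Qed.

(** Truncating before or after multiplying gives the same coefficients below degree [n]. *)
Lemma partial_sumM F G x e n : 0 < e -> supp_ge e x ->
  supp_ge (e *+ n) (partial_sum iota (F * G) x n -
                    partial_sum iota F x n * partial_sum iota G x n).
Proof.
move=> e0 ex; rewrite !partial_sum_map -hornerM -rmorphM -hornerN -hornerD -rmorphB.
apply: supp_ge_low_coefs0 => // i ltin; rewrite coefB coef_poly ltin coefM fcoefM.
apply/eqP; rewrite subr_eq0; apply/eqP/eq_bigr => j _.
by rewrite !coef_poly (leq_ltn_trans (leq_subr _ _) ltin) (leq_ltn_trans _ ltin)// -ltnS.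
Qed.

Lemma fps_root_supp_ge F x e : 0 < e ->
  (forall n, supp_ge (e *+ n) (partial_sum iota F x n)) -> fps_root iota F x.
Proof.
move=> e0 Fx A [r _ rA]; have [N NP] := rat_archimedean r e0; exists N => // n /= leNn.
apply: rA => /=; rewrite subr0; apply/lt_hvalP => a /Fx; apply: lt_le_trans.
exact: NP.
Qed.

(** Writing [q] as [F * u^-1], q(x) is, up to valuation [e *+ n], a truncation of [F] times an
    integral element; so its valuation exceeds every bound. *)
Lemma factor_root (F u : fps {poly k}) (q : {poly {poly k}}) x e :
  0 < e -> supp_ge e x -> (forall n, supp_ge (e *+ n) (partial_sum iota F x n)) ->
  u \is a GRing.unit -> F = fps_of_poly q * u -> root (map_poly hp q) x.
Proof.
move=> e0 ex Fx uu EF; have x0 : supp_ge 0 x := supp_ge_le (ltW e0) ex.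
apply/eqP/supp_ge_eq0 => r; have [N NP] := rat_archimedean r e0.
pose n := maxn N (size q).
have -> : (map_poly hp q).[x] = partial_sum iota (fps_of_poly q) x n.
  rewrite partial_sum_map; congr (map_poly _ _).[x]; apply/polyP => i.
  rewrite coef_poly; case: ltnP => //= leni; rewrite nth_default//.
  exact: leq_trans (leq_maxr _ _) leni.
have -> : fps_of_poly q = F * u^-1 by rewrite EF mulrK.
rewrite -[partial_sum _ _ _ _](subrK
  (partial_sum iota F x n * partial_sum iota u^-1 x n)).
apply: (@supp_ge_le _ _ (e *+ n)); first by apply/ltW/NP; exact: leq_maxl.
apply: supp_geD; first exact: partial_sumM.
by apply: supp_geM0 (Fx n) _ (lexx _); exact: supp_ge_partial_sum.
Qed.

End PartialSums.

(** * Transcendence of roots of lacunary series *)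

Section Lacunary.
Variables (k K : fieldType) (iota : {rmorphism k -> K}).
Variables (b : nat -> nat) (a : nat -> {poly k}).
Hypothesis b_incr : {homo b : m n / (m < n)%N}.

Lemma lacunary_coef_gap n m : (b n < m < b n.+1)%N -> lacunary b a m = 0.
Proof.
move=> /andP[ltbm ltmb]; apply: lacunary_coef0 => i E.
move: ltbm ltmb; rewrite -E !(leqW_mono (leq_mono b_incr)).
by rewrite ltnS => /leq_trans /[apply]; rewrite ltnn.
Qed.

Lemma partial_sum_gap x n :
  partial_sum iota (lacunary b a) x (b n.+1) = partial_sum iota (lacunary b a) x (b n).+1.
Proof.
rewrite /partial_sum.
rewrite -!(big_mkord predT (fun i => hahn_of_poly iota (lacunary b a i) * x ^+ i)).
rewrite (big_cat_nat (n := (b n).+1)) ?b_incr// -[RHS]addr0; congr (_ + _).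
rewrite big_nat_cond big1// => i /andP[/lacunary_coef_gap -> _].
by rewrite rmorph0 mul0r.
Qed.

Hypothesis b0 : (0 < b 0)%N.

Lemma lacunary_root_transcendental (C : nat) (e : rat) (x : hahn K) :
  (forall T, exists N, forall n, (N <= n)%N -> (T * b n < b n.+1)%N) ->
  (forall n, a n != 0) ->
  (forall n, (size (a n)).-1 <= C * b n)%N ->
  0 < e -> supp_ge e x -> x != 0 ->
  (forall n, supp_ge (e *+ n) (partial_sum iota (lacunary b a) x n)) ->
  ~ algebraicOver (hahn_of_frac iota) x.
Proof.
move=> b_ratio a_neq0 deg_a e0 ex xn0 Fx algx.
have b_gt0 n : (0 < b n)%N.
  by case: n => // n; apply: leq_ltn_trans (b_incr (ltn0Sn n)).
have [c cP] := liouville (supp_ge_le (ltW e0) ex) algx.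
pose f := lacunary b a.
(* The gap makes this sum a polynomial of x-degree [b n], while its valuation is at least
   [e *+ b n.+1]; Liouville compares the two. *)
have bound n : partial_sum iota f x (b n.+1) != 0 ->
    e *+ b n.+1 <= (c * ((1 + C) * b n))%:R.
  move=> nz; have := Fx (b n.+1); move: nz; rewrite -/f /f partial_sum_gap -/f.
  rewrite partial_sum_map; set Q := \poly_(i < _) _ => Qx QB.
  have sQ : (size Q <= (b n).+1)%N := size_poly _ _.
  have sQ1 : (1 < size Q)%N.
    rewrite ltnNge; apply/negP => sQ1.
    have : Q`_(b n) != 0 by rewrite coef_poly ltnSn lacunary_coef.
    by rewrite nth_default ?eqxx// (leq_trans sQ1).
  have Qd i : (size (Q`_i)%R <= (C * b n).+1)%N.
    rewrite coef_poly; case: ifP => [lti|_]; last by rewrite size_poly0.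
    have [[m Em]|nb] := pselect (exists m, b m = i); last first.
      rewrite lacunary_coef0 ?size_poly0// => m Em; apply: nb; by exists m.
    rewrite -Em lacunary_coef//; apply: leq_trans (leqSpred _) _; rewrite ltnS.
    by apply: leq_trans (deg_a m) _; rewrite leq_mul2l orbC Em -ltnS lti.
  apply: le_trans (cP Q _ _ sQ1 Qd Qx QB) _; rewrite ler_nat leq_mul2l orbC.
  by rewrite mulnDl mul1n leq_add2r -ltnS (ltn_predK sQ1) sQ.
have [N0 N0P] := rat_archimedean (c * (1 + C))%:R e0.
have [N NP] := b_ratio N0.
have psum0 n : (N <= n)%N -> partial_sum iota f x (b n.+1) = 0.
  move=> /NP ltb; apply/eqP; apply: contraT => /bound; rewrite leNgt mulnA natrM.
  rewrite mulr_natr; have := N0P N0 (leqnn _) => lt; case/negP.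
  apply: lt_trans (_ : e *+ (N0 * b n) < _); last by rewrite ltr_pMn2l.
  by rewrite [e *+ _]mulrnA ltr_pMn2r.
(* Two consecutive vanishing sums differ by the nonzero term of index [N.+1]. *)
have := psum0 N.+1 (leqnSn N); rewrite partial_sum_gap partial_sumS psum0// add0r /f.
move/eqP; rewrite lacunary_coef// mulf_eq0 hahn_of_poly_eq0.
by rewrite (negPf (a_neq0 _)) expf_eq0 (negPf xn0) andbF.
Qed.

End Lacunary.

(** * Application to the given series over F_p[t] *)

Theorem theorem5p6 (R : realType) (p : nat) (p_prime : prime p)
    (K : closedFieldType) (iota : {rmorphism 'F_p -> K})
    (K_algebraic : forall x : K, algebraicOver iota x)
    (b : nat -> nat) (a : nat -> {poly 'F_p})
    (b_incr : {homo b : m n / (m < n)%N})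
    (b0 : b 0%N = 1%N)
    (b_ratio : ((b n.+1)%:R / (b n)%:R : R) @[n --> \oo] --> +oo)
    (a_neq0 : forall n, a n != 0)
    (a0 : 'X %| a 0%N)
    (ai : exists i, (0 < i)%N /\ ~~ ('X %| a i))
    (deg_a : exists C : R, 0 < C /\
      forall n, (1 <= n)%N -> (size (a n)).-1%:R <= C * (b n)%:R) :
  (exists lambda : hahn K,
     [/\ lambda \in hahn_pos K,
         fps_root iota (lacunary b a) lambda
       & ~ algebraicOver (hahn_of_frac iota) lambda])
  /\ ~ (exists (q : {poly {poly 'F_p}}) (u : fps {poly 'F_p}),
         u \is a GRing.unit /\ lacunary b a = fps_of_poly q * u).
Proof.
pose f := lacunary b a; pose hp := hahn_of_poly iota.
have b_gt0 n : (0 < b n)%N.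
  by case: n => [|n]; [rewrite b0|apply: leq_ltn_trans (b_incr _ _ (ltn0Sn n))].
have [C degC] : exists C : nat, forall n, ((size (a n)).-1 <= C * b n)%N.
  (* The added degree of [a 0] extends the bound to [n = 0], where [b 0 = 1]. *)
  have [C [C0 CP]] := deg_a; exists ((size (a 0)).-1 + Num.bound C)%N => -[|n].
    by rewrite b0 muln1 leq_addr.
  rewrite mulnDl; apply: leq_trans (leq_addl _ _).
  rewrite -(ler_nat R) natrM; apply: le_trans (CP n.+1 _) _ => //.
  by rewrite ler_wpM2r// ltW// archi_boundP// ltW.
have ratio T : exists N, forall n, (N <= n)%N -> (T * b n < b n.+1)%N.
  have /cvgryPgt/(_ T%:R)[N _ NP] := b_ratio; exists N => n /NP /=.
  by rewrite ltr_pdivlMr ?ltr0n// -natrM ltr_nat.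
have f0 : f 0%N = 0 by rewrite lacunary_coef0// => n E; have := b_gt0 n; rewrite E.
have f1 : f 1%N = a 0%N by rewrite -b0 /f lacunary_coef.
have hp0 (F : {poly 'F_p}) : hp F 0 = iota F`_0 := hcoef_hahn_of_poly iota F 0.
have [i [i_gt0 ai0]] := ai.
have bi : (1 < b i)%N by rewrite -b0 b_incr.
have X_coef (F : {poly 'F_p}) : ('X %| F) = (F`_0 == 0).
  by rewrite -['X]subr0 -polyC0 dvdp_XsubCl rootE horner_coef0.
(* Dividing by x shifts indices by one: the constant term becomes [a 0], and the unit [a i] sits at
   [(b i).-1 > 0]. *)
have [||||lambda [e [e0 el Fl]]] := @series_root K (fun m => hp (f m.+1)) (b i).-1.
- by move=> m; exact: hahn_of_poly_supp_ge.
- by rewrite -ltnS prednK// b_gt0.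
- by rewrite f1 hp0; move: a0; rewrite X_coef => /eqP ->; rewrite rmorph0.
- by rewrite (prednK (b_gt0 i)) /f lacunary_coef// hp0 fmorph_eq0 -X_coef.
have Fn n : supp_ge (e *+ n) (partial_sum iota f lambda n).
  case: n => [|n]; first by rewrite /partial_sum big_ord0; exact: supp_ge0.
  rewrite /partial_sum big_ord_recl f0 rmorph0 mul0r add0r.
  under eq_bigr do rewrite exprS mulrCA; rewrite -mulr_sumr mulrS.
  by apply: supp_geM => //; have := Fl n; rewrite horner_poly.
(* At 0 the truncations of f / x all equal [a 0], whose valuation would be infinite. *)
have l0 : lambda != 0.
  apply/eqP => l0; have : hp (a 0%N) = 0.
    apply: supp_ge_eq0 => r; have [N NP] := rat_archimedean r e0.
    have := Fl N.+1; rewrite l0 horner_coef0 coef_poly ltn0Sn f1.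
    by apply: supp_ge_le; apply/ltW/NP.
  by move/eqP; rewrite hahn_of_poly_eq0 (negPf (a_neq0 _)).
have ltrans : ~ algebraicOver (hahn_of_frac iota) lambda.
  exact: (lacunary_root_transcendental b_incr (b_gt0 0%N) ratio a_neq0 degC e0 el l0 Fn).
split.
  exists lambda; split=> //; last exact: fps_root_supp_ge e0 Fn.
  by rewrite inE; apply/hval_gt0P; exists e.
move=> [q [u [uu Ef]]]; apply: ltrans; apply/algebraicOver_frac; exists q.
  apply: contraNneq (a_neq0 0%N) => q0.
  by rewrite -f1 /f Ef q0 rmorph0 mul0r /= coef0.
exact: factor_root e0 el Fn uu Ef.
Qed.
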